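(* For every integer $k\ge 0$ one has $\Xi_2^{[k,k+1]}=\Xi_2^{[k+1,k]}$, and this function satisfies, for $0<x<1$, the differential-difference relation $$ \frac12\left(\frac1x+(1-x^2)\frac{d}{dx}\right)\Xi_2^{[k,k+1]}(x)=\left(k+\tfrac14\right)\Xi_2^{[k,k]}(x)-\left(k+\tfrac34\right)\Xi_2^{[k+1,k+1]}(x). $$
   Context: For non-negative integers $k_1,k_2$ and $0\le x<1$ the rank-2 function is defined by $$ \Xi_2^{[k_1,k_2]}(x):=\frac14\int_0^{\pi}\!\!\int_0^{\pi}\frac{\cos(k_1\theta_1)\cos(k_2\theta_2)}{\sqrt{1+x^2-x(\cos\theta_1+\cos\theta_2)}}\,d\theta_1\,d\theta_2 . $$ *)

(* Defs.v *)
From Stdlib Require Import Reals.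
From Coquelicot Require Import Coquelicot.
Open Scope R_scope.

(* For 0 <= x < 1 the radicand is at least (1 - x)^2 > 0, so the integrand is
   continuous and both Riemann integrals exist; for other x the total
   functions sqrt, Rinv and RInt may return meaningless values. *)
Definition Xi2 (k1 k2 : nat) (x : R) : R :=
  / 4 * RInt (fun theta2 : R => RInt (fun theta1 : R =>
          cos (INR k1 * theta1) * cos (INR k2 * theta2)
          / sqrt (1 + x ^ 2 - x * (cos theta1 + cos theta2))) 0 PI) 0 PI.

(* Main.v *)
Require Import Defs.
From Stdlib Require Import Reals Lra ClassicalEpsilon.
From Coquelicot Require Import Coquelicot.
Open Scope R_scope.

(* Differentiating under the integral sign, the relation says that the integral over
   [0, PI]^2 of an explicit function [defect] vanishes. By Fubini only the sum
   defect(s,t) + defect(t,s) matters, and this is a divergence: it equals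
   2 (d/ds flux(s,t) + d/dt flux(t,s)), where flux vanishes at s = 0 and s = PI. *)

(** * Integrals depending on a parameter: continuity and differentiation *)

(** Compactness of [a, b] turns joint continuity at each (u0, t) into closeness of [f u] to [f u0]
    uniform in t. The space [U] is general because the parameter is later a real or a pair of
    reals. *)
Lemma continuous_RInt_param {U : UniformSpace} (f : U -> R -> R) (a b : R) (u0 : U) :
  a <= b ->
  (forall t, continuous (fun p : U * R => f (fst p) (snd p)) (u0, t)) ->
  locally u0 (fun u => ex_RInt (f u) a b) ->
  continuous (fun u => RInt (f u) a b) u0.
Proof.
  intros ab cont int.
  apply filterlim_locally; intros eps.
  (* The integrands will differ by at most 2 eps', hence the integrals by at most eps (b - a) / (b -
     a + 1) < eps; the + 1 covers a = b. *)
  assert (eps'_pos : 0 < eps / (2 * (b - a + 1))).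
  { apply Rdiv_lt_0_compat; [apply cond_pos | lra]. }
  pose (eps' := mkposreal _ eps'_pos).
  (* Compactness takes a gauge function, so the radius at each t has to be chosen, not merely
     exist. *)
  assert (near : forall t, {d : posreal | forall u v, ball u0 d u -> ball t d v ->
            ball (f u0 t) eps' (f u v)}).
  { intros t; apply constructive_indefinite_description.
    destruct (proj1 (filterlim_locally _ _) (cont t) eps') as [d Hd].
    exists d; intros u v Hu Hv; apply (Hd (u, v)); now split. }
  destruct (compactness_value_1d a b (fun t => proj1_sig (near t))) as [d Hd].
  assert (Hball : locally u0 (ball u0 d)) by now exists d.
  generalize (filter_and _ _ Hball int); apply filter_imp.
  intros u [Hu intu].
  pose proof (locally_singleton _ _ int) as intu0.
  change (Rabs (minus (RInt (f u) a b) (RInt (f u0) a b)) < eps).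
  rewrite <- RInt_minus by assumption.
  assert (bound : Rabs (RInt (fun t => minus (f u t) (f u0 t)) a b)
            <= (b - a) * (2 * eps')).
  { apply abs_RInt_le_const; [exact ab | now apply @ex_RInt_minus |].
    intros t Ht.
    (* The covering point s exists only under a double negation, hence the argument by
       contradiction. *)
    apply Rnot_lt_le; intros Hlt.
    apply (Hd t Ht); intros (s & _ & Hts & Hds).
    destruct (near s) as [e He]; simpl in Hts, Hds.
    assert (B1 : ball (f u0 s) eps' (f u t)).
    { apply He; [now apply ball_le with d | exact Hts]. }
    assert (B2 : ball (f u0 s) eps' (f u0 t)).
    { apply He; [apply ball_center | exact Hts]. }
    apply ball_sym in B2.
    pose proof (ball_triangle _ _ _ _ _ B2 B1) as B.
    change (Rabs (f u t - f u0 t) < eps' + eps') in B.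
    change (2 * eps' < Rabs (f u t - f u0 t)) in Hlt.
    lra. }
  apply Rle_lt_trans with (1 := bound); simpl.
  pose proof (cond_pos eps) as eps_pos.
  replace ((b - a) * (2 * (eps / (2 * (b - a + 1)))))
    with (eps * ((b - a) / (b - a + 1))) by (field; lra).
  rewrite <- (Rmult_1_r eps) at 2.
  apply Rmult_lt_compat_l; [exact eps_pos |].
  apply Rlt_div_l; lra.
Qed.

Lemma continuous_slice_l {U V W : UniformSpace} (f : U -> V -> W) (u : U) (v : V) :
  continuous (fun p : U * V => f (fst p) (snd p)) (u, v) ->
  continuous (fun w => f w v) u.
Proof.
  intros H; apply (continuous_comp_2 (fun w => w) (fun _ => v) f);
    [apply continuous_id | apply continuous_const | exact H].
Qed.

Lemma continuous_slice_r {U V W : UniformSpace} (f : U -> V -> W) (u : U) (v : V) :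
  continuous (fun p : U * V => f (fst p) (snd p)) (u, v) ->
  continuous (f u) v.
Proof.
  intros H; apply (continuous_comp_2 (fun _ => u) (fun w => w) f);
    [apply continuous_const | apply continuous_id | exact H].
Qed.

(** An explicit derivative [df] replaces [Derive], and the hypotheses are confined to an open set of
    parameters, since the radicand is positive only for restricted x. *)
Lemma is_derive_RInt_param_open (O : R -> Prop) (f df : R -> R -> R) (a b x : R) :
  open O -> O x ->
  (forall y t, O y -> is_derive (fun z => f z t) y (df y t)) ->
  (forall y t, O y -> continuous (fun p : R * R => df (fst p) (snd p)) (y, t)) ->
  (forall y t, O y -> continuous (f y) t) ->
  is_derive (fun y => RInt (f y) a b) x (RInt (df x) a b).
Proof.
  intros openO Ox Hd cdf cf.
  rewrite (RInt_ext (df x) (fun t => Derive (fun z => f z t) x)).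
  2: { intros t _; symmetry; now apply is_derive_unique, Hd. }
  apply is_derive_RInt_param.
  - generalize (openO x Ox); apply filter_imp; intros y Oy t _.
    exists (df y t); now apply Hd.
  - intros t _; apply continuity_2d_pt_filterlim.
    replace (Derive (fun z : R => f z t) x) with (df x t)
      by now symmetry; apply is_derive_unique, Hd.
    (* [Derive] agrees with [df] only over [O], so continuity is carried across a local equality. *)
    apply filterlim_ext_loc with (2 := cdf x t Ox).
    destruct (openO x Ox) as [d Hball].
    exists d; intros [y s] [Hy _]; simpl in *.
    symmetry; apply is_derive_unique, Hd, Hball, Hy.
  - generalize (openO x Ox); apply filter_imp; intros y Oy.
    apply (ex_RInt_continuous (V := R_CompleteNormedModule)).
    intros z _; now apply cf.
Qed.

(** * Iterated integrals over rectangles *)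

Definition continuous2 (f : R -> R -> R) : Prop :=
  forall s t, continuous (fun p : R * R => f (fst p) (snd p)) (s, t).

(** The first variable is the inner one, as in [Xi2], so that [Xi2_RInt2] holds by conversion. *)
Definition RInt2 (f : R -> R -> R) (a b c d : R) : R :=
  RInt (fun t => RInt (fun s => f s t) a b) c d.

Lemma continuous2_swap (f : R -> R -> R) :
  continuous2 f -> continuous2 (fun s t => f t s).
Proof.
  intros cf s t.
  apply (continuous_comp_2 (fun p : R * R => snd p) (fun p : R * R => fst p) f);
    [apply continuous_snd | apply continuous_fst | apply cf].
Qed.

Lemma continuous2_ex_RInt_l (f : R -> R -> R) (a b t : R) :
  continuous2 f -> ex_RInt (fun s => f s t) a b.
Proof.
  intros cf; apply (ex_RInt_continuous (V := R_CompleteNormedModule)); intros s _.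
  now apply (continuous_slice_l f).
Qed.

Lemma continuous2_RInt_l (f : R -> R -> R) (a b t : R) :
  a <= b -> continuous2 f -> continuous (fun t => RInt (fun s => f s t) a b) t.
Proof.
  intros ab cf; apply (continuous_RInt_param (fun t s => f s t)); [exact ab | |].
  - intros s; now apply continuous2_swap.
  - apply filter_forall; intros u; now apply continuous2_ex_RInt_l.
Qed.

Lemma continuous2_ex_RInt2 (f : R -> R -> R) (a b c d : R) :
  a <= b -> continuous2 f -> ex_RInt (fun t => RInt (fun s => f s t) a b) c d.
Proof.
  intros ab cf; apply (ex_RInt_continuous (V := R_CompleteNormedModule)); intros t _.
  now apply continuous2_RInt_l.
Qed.

(* Both iterated integrals over [a,b] x [c,t] have the same derivative in t. *)
Lemma RInt2_swap (f : R -> R -> R) (a b c d : R) :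
  a <= b -> c <= d -> continuous2 f ->
  RInt2 f a b c d = RInt2 (fun s t => f t s) c d a b.
Proof.
  intros ab [cd | <-] cf; unfold RInt2.
  2: { rewrite RInt_point, (RInt_ext _ (fun _ => 0)), RInt_const.
       - unfold scal, zero; simpl; unfold mult; simpl; ring.
       - intros s _; apply (RInt_point (V := R_CompleteNormedModule)). }
  pose (phi := fun r => RInt (fun t => RInt (fun s => f s t) a b) c r
                 - RInt (fun s => RInt (fun t => f s t) c r) a b).
  assert (Hphi : phi c = phi d).
  { apply (eq_is_derive (V := R_NormedModule)); [| exact cd]; intros r _.
    (* The zero derivative is written as a difference of two equal integrals, one from each term of
       [phi]. *)
    refine (eq_ind _ (fun l => is_derive phi r l) _ _
      (Rminus_diag (RInt (fun s => f s r) a b))).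
    apply (is_derive_minus (K := R_AbsRing) (V := R_NormedModule)).
    - apply (is_derive_RInt (fun t => RInt (fun s => f s t) a b) _ c r).
      + apply filter_forall; intros r'; apply (@RInt_correct R_CompleteNormedModule).
        now apply continuous2_ex_RInt2.
      + now apply continuous2_RInt_l.
    - apply (is_derive_RInt_param_open (fun _ => True)
               (fun r s => RInt (fun t => f s t) c r) (fun r s => f s r)).
      + apply open_true.
      + exact I.
      + intros y s _; apply (is_derive_RInt (fun t => f s t) _ c y).
        * apply filter_forall; intros r'; apply (@RInt_correct R_CompleteNormedModule).
          now apply (continuous2_ex_RInt_l (fun t s => f s t)), continuous2_swap.
        * now apply (continuous_slice_r f).
      + intros y s _; now apply continuous2_swap.
      + intros y s _.
        (* The parameter set is all of R, so y < c occurs too; there the bounds are reversed. *)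
        destruct (Rle_or_lt c y) as [cy | yc].
        * now apply (continuous2_RInt_l (fun t s => f s t)), continuous2_swap.
        * apply (continuous_ext (fun s => opp (RInt (fun t => f s t) y c))).
          { intros s'; apply opp_RInt_swap.
            now apply (continuous2_ex_RInt_l (fun t s => f s t)), continuous2_swap. }
          apply (continuous_opp (V := R_NormedModule)).
          apply (continuous2_RInt_l (fun t s => f s t)); [lra |].
          now apply continuous2_swap. }
  unfold phi in Hphi; rewrite RInt_point in Hphi.
  rewrite (RInt_ext (fun s => RInt _ c c) (fun _ => 0)), RInt_const in Hphi.
  2: intros s _; apply (RInt_point (V := R_CompleteNormedModule)).
  unfold minus, plus, opp, scal, zero in Hphi; simpl in Hphi;
    unfold mult in Hphi; simpl in Hphi; lra.
Qed.

Lemma continuous2_lin (f g : R -> R -> R) (p q : R) :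
  continuous2 f -> continuous2 g -> continuous2 (fun s t => p * f s t + q * g s t).
Proof.
  intros cf cg s t.
  apply (continuous_plus (V := R_NormedModule));
    apply (continuous_scal_r (V := R_NormedModule)); [apply cf | apply cg].
Qed.

Lemma RInt_lin (f g : R -> R) (p q a b : R) :
  ex_RInt f a b -> ex_RInt g a b ->
  RInt (fun t => p * f t + q * g t) a b = p * RInt f a b + q * RInt g a b.
Proof.
  intros intf intg.
  rewrite (RInt_plus (V := R_CompleteNormedModule) (fun t => p * f t) (fun t => q * g t)).
  - now rewrite (RInt_scal (V := R_CompleteNormedModule) f),
      (RInt_scal (V := R_CompleteNormedModule) g).
  - now apply (ex_RInt_scal (V := R_CompleteNormedModule)).
  - now apply (ex_RInt_scal (V := R_CompleteNormedModule)).
Qed.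

Lemma RInt2_lin (f g : R -> R -> R) (p q a b c d : R) :
  a <= b -> continuous2 f -> continuous2 g ->
  RInt2 (fun s t => p * f s t + q * g s t) a b c d
  = p * RInt2 f a b c d + q * RInt2 g a b c d.
Proof.
  intros ab cf cg; unfold RInt2.
  rewrite <- RInt_lin by now apply continuous2_ex_RInt2.
  apply RInt_ext; intros t _.
  now apply RInt_lin; apply continuous2_ex_RInt_l.
Qed.

Lemma RInt2_ext (f g : R -> R -> R) (a b c d : R) :
  (forall s t, f s t = g s t) -> RInt2 f a b c d = RInt2 g a b c d.
Proof.
  intros E; apply RInt_ext; intros t _; apply RInt_ext; intros s _; apply E.
Qed.

(** * The integrand and its derivative in x *)

Definition radicand (x s t : R) : R := 1 + x ^ 2 - x * (cos s + cos t).

(** The frequencies are real, so a + 1 needs no cast; integrality enters only through the vanishing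
    of sines at PI. *)
Definition kernel (a b x s t : R) : R :=
  cos (a * s) * cos (b * t) / sqrt (radicand x s t).

Definition dkernel (a b x s t : R) : R :=
  - (cos (a * s) * cos (b * t)) * (2 * x - (cos s + cos t))
  / (2 * (radicand x s t * sqrt (radicand x s t))).

(** As cos s + cos t lies in [-2, 2], the radicand is at least (1 - x)^2 or (1 + x)^2, according to
    the sign of x. The range is open, as differentiation requires, and contains x = 0. *)
Lemma radicand_pos (x s t : R) : -1 < x < 1 -> 0 < radicand x s t.
Proof.
  intros Hx; unfold radicand.
  pose proof (COS_bound s); pose proof (COS_bound t).
  assert (0 < (1 - x) ^ 2) by (apply pow_lt; lra).
  assert (0 < (1 + x) ^ 2) by (apply pow_lt; lra).
  destruct (Rle_or_lt 0 x); nra.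
Qed.

Lemma radicand_swap (x s t : R) : radicand x s t = radicand x t s.
Proof. unfold radicand; ring. Qed.

(** Inverses are not entered: continuity of a reciprocal needs a nonzero denominator and must
    already be in the context. *)
Ltac continuity :=
  try assumption;
  lazymatch goal with
  | |- continuous (fun _ => ?c) _ => apply continuous_const
  | |- continuous (fun v => @?f v + @?g v) ?u =>
      refine (continuous_plus (V := R_NormedModule) f g u _ _); continuity
  | |- continuous (fun v => @?f v - @?g v) ?u =>
      refine (continuous_minus (V := R_NormedModule) f g u _ _); continuity
  | |- continuous (fun v => - @?f v) ?u =>
      refine (continuous_opp (V := R_NormedModule) f u _); continuity
  | |- continuous (fun v => @?f v * @?g v) ?u =>
      refine (continuous_mult (K := R_AbsRing) f g u _ _); continuity
  | |- continuous (fun v => @?f v / @?g v) ?u =>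
      refine (continuous_mult (K := R_AbsRing) f (fun v => / g v) u _ _); continuity
  | |- continuous (fun v => cos (@?f v)) ?u =>
      refine (continuous_comp f cos u _ (continuous_cos _)); continuity
  | |- continuous (fun v => sin (@?f v)) ?u =>
      refine (continuous_comp f sin u _ (continuous_sin _)); continuity
  | |- continuous (fun v => sqrt (@?f v)) ?u =>
      refine (continuous_comp f sqrt u _ (continuous_sqrt _)); continuity
  | _ => idtac
  end.

(** With x, s, t as functions on an arbitrary space, one proof serves every choice of which of them
    vary. *)
Section Continuity.

Context {U : UniformSpace} (X S T : U -> R) (u : U).
Hypotheses (cX : continuous X u) (cS : continuous S u) (cT : continuous T u).
Hypothesis HX : -1 < X u < 1.

Lemma continuous_radicand : continuous (fun v => radicand (X v) (S v) (T v)) u.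
Proof. unfold radicand, pow; continuity. Qed.

Lemma continuous_inv_sqrt_radicand :
  continuous (fun v => / sqrt (radicand (X v) (S v) (T v))) u.
Proof.
  refine (continuous_comp _ Rinv _ _ (continuous_Rinv _ _)).
  - pose proof continuous_radicand; continuity.
  - apply Rgt_not_eq, sqrt_lt_R0, radicand_pos, HX.
Qed.

Lemma continuous_kernel (a b : R) : continuous (fun v => kernel a b (X v) (S v) (T v)) u.
Proof.
  pose proof continuous_inv_sqrt_radicand.
  unfold kernel; continuity.
Qed.

Lemma continuous_dkernel (a b : R) : continuous (fun v => dkernel a b (X v) (S v) (T v)) u.
Proof.
  assert (continuous (fun v => / (2 * (radicand (X v) (S v) (T v)
                                       * sqrt (radicand (X v) (S v) (T v))))) u).
  { pose proof (radicand_pos _ (S u) (T u) HX) as Hpos.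
    refine (continuous_comp _ Rinv _ _ (continuous_Rinv _ _)).
    - pose proof continuous_radicand; continuity.
    - apply sqrt_lt_R0 in Hpos as Hsqrt.
      apply Rgt_not_eq, Rmult_lt_0_compat; [lra |].
      now apply Rmult_lt_0_compat. }
  unfold dkernel; continuity.
Qed.

End Continuity.

Lemma is_derive_kernel (a b x s t : R) :
  -1 < x < 1 -> is_derive (fun y => kernel a b y s t) x (dkernel a b x s t).
Proof.
  intros Hx; pose proof (radicand_pos x s t Hx) as Hpos.
  apply sqrt_lt_R0 in Hpos as Hsqrt.
  unfold kernel, dkernel; unfold radicand in *.
  auto_derive.
  - replace (1 + x * (x * 1) + - (x * (cos s + cos t)))
      with (1 + x ^ 2 - x * (cos s + cos t)) by ring.
    repeat split; try assumption; lra.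
  - replace (1 + x * (x * 1) + - (x * (cos s + cos t)))
      with (1 + x ^ 2 - x * (cos s + cos t)) by ring.
    (* Once D is replaced by r * r, with r its square root, the claim is a rational identity in
       r. *)
    set (D := 1 + x ^ 2 - x * (cos s + cos t)) in *.
    pose proof (sqrt_sqrt D (Rlt_le _ _ Hpos)) as HD.
    set (r := sqrt D) in *; clearbody r D; subst D.
    field; lra.
Qed.

Lemma continuous2_kernel (a b x : R) : -1 < x < 1 -> continuous2 (kernel a b x).
Proof.
  intros Hx s t.
  apply (continuous_kernel (fun _ => x) fst snd);
    [apply continuous_const | apply continuous_fst | apply continuous_snd | exact Hx].
Qed.

Lemma continuous2_dkernel (a b x : R) : -1 < x < 1 -> continuous2 (dkernel a b x).
Proof.
  intros Hx s t.
  apply (continuous_dkernel (fun _ => x) fst snd);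
    [apply continuous_const | apply continuous_fst | apply continuous_snd | exact Hx].
Qed.

Lemma is_derive_RInt2_kernel (a b x : R) :
  -1 < x < 1 ->
  is_derive (fun y => RInt2 (kernel a b y) 0 PI 0 PI) x (RInt2 (dkernel a b x) 0 PI 0 PI).
Proof.
  intros Hx; pose proof PI_RGT_0 as PIpos.
  assert (open_unit : open (fun y => -1 < y < 1)).
  { apply open_and; [apply open_gt | apply open_lt]. }
  apply (is_derive_RInt_param_open (fun y => -1 < y < 1)
    (fun y t => RInt (fun s => kernel a b y s t) 0 PI)
    (fun y t => RInt (fun s => dkernel a b y s t) 0 PI)); [exact open_unit | exact Hx | | |].
  - intros y t Hy.
    apply (is_derive_RInt_param_open (fun y => -1 < y < 1)
      (fun y s => kernel a b y s t) (fun y s => dkernel a b y s t));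
      [exact open_unit | exact Hy | | |].
    + intros z s; apply is_derive_kernel.
    + intros z s Hz.
      apply (continuous_dkernel fst snd (fun _ => t));
        [apply continuous_fst | apply continuous_snd | apply continuous_const | exact Hz].
    + intros z s Hz.
      apply (continuous_kernel (fun _ => z) (fun s => s) (fun _ => t));
        [apply continuous_const | apply continuous_id | apply continuous_const | exact Hz].
  - intros y t Hy.
    (* The outer differentiation needs the inner integral continuous jointly in (y, t), so the
       parameter is a pair. *)
    apply (continuous_RInt_param (fun (p : R * R) s => dkernel a b (fst p) s (snd p))); [lra | |].
    + intros s.
      apply (continuous_dkernel (fun q : (R * R) * R => fst (fst q)) snd (fun q => snd (fst q)));
        [| apply continuous_snd | | exact Hy].
      * refine (continuous_comp fst fst _ (continuous_fst _ _) (continuous_fst _ _)).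
      * refine (continuous_comp fst snd _ (continuous_fst _ _) (continuous_snd _ _)).
    + assert (Hloc : locally (y, t) (fun p : R * R => -1 < fst p < 1)).
      { exact (continuous_fst y t _ (open_unit y Hy)). }
      generalize Hloc; apply filter_imp; intros [z r] Hz.
      now apply (continuous2_ex_RInt_l (dkernel a b z)), continuous2_dkernel.
  - intros y t Hy; apply continuous2_RInt_l; [lra |]; now apply continuous2_kernel.
Qed.

(** * The flux and the divergence identity *)

Lemma sin_INR_PI (k : nat) : sin (INR k * PI) = 0.
Proof.
  induction k as [| k IH].
  - now rewrite Rmult_0_l, sin_0.
  - rewrite S_INR, Rmult_plus_distr_r, Rmult_1_l, neg_sin, IH; ring.
Qed.

(* The flux is obtained in the coordinates u = (s + t)/2, v = (s - t)/2, where the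
   radicand is 1 + x^2 - 2 x cos u cos v and the vector field is
   cos ((2k+1) u) / sqrt (radicand) * (sin u, (1 + x^2) / (2 x) * sin v); it is then
   averaged over the reflections of s and t. *)
Definition flux (a x s t : R) : R :=
  1 / 2 * (sin ((a + 1) * s) * cos ((a + 1) * t) - sin (a * s) * cos (a * t)
    + (1 + x ^ 2) / (2 * x) * (sin ((a + 1) * s) * cos (a * t) - sin (a * s) * cos ((a + 1) * t)))
  / sqrt (radicand x s t).

(** Differentiating the sines gives kernels, whose continuity is known; the last term comes from the
    inverse square root, the radicand having s-derivative x sin s. *)
Definition dflux (a x s t : R) : R :=
  1 / 2 * ((a + 1) * kernel (a + 1) (a + 1) x s t - a * kernel a a x s t
    + (1 + x ^ 2) / (2 * x) * ((a + 1) * kernel (a + 1) a x s t - a * kernel a (a + 1) x s t))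
  - flux a x s t * (x * sin s) / (2 * radicand x s t).

Lemma is_derive_flux (a x s t : R) :
  0 < x < 1 -> is_derive (fun r => flux a x r t) s (dflux a x s t).
Proof.
  intros Hx; assert (Hx' : -1 < x < 1) by lra.
  pose proof (radicand_pos x s t Hx') as Hpos.
  apply sqrt_lt_R0 in Hpos as Hsqrt.
  unfold flux, dflux, flux, kernel; unfold radicand in *.
  auto_derive;
    replace (1 + x * (x * 1) + - (x * (cos s + cos t)))
      with (1 + x ^ 2 - x * (cos s + cos t)) by ring.
  - repeat split; lra.
  - set (D := 1 + x ^ 2 - x * (cos s + cos t)) in *.
    pose proof (sqrt_sqrt D (Rlt_le _ _ Hpos)) as HD.
    set (r := sqrt D) in *; clearbody r D; subst D.
    field; lra.
Qed.

Lemma continuous2_dflux (a x : R) : 0 < x < 1 -> continuous2 (dflux a x).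
Proof.
  intros Hx s t; assert (Hx' : -1 < x < 1) by lra.
  pose proof (radicand_pos x s t Hx') as Hpos.
  pose proof (continuous_fst s t) as cs; pose proof (continuous_snd s t) as ct.
  pose proof (continuous2_kernel (a + 1) (a + 1) x Hx' s t).
  pose proof (continuous2_kernel a a x Hx' s t).
  pose proof (continuous2_kernel (a + 1) a x Hx' s t).
  pose proof (continuous2_kernel a (a + 1) x Hx' s t).
  pose proof (continuous_const x (s, t)) as cx.
  pose proof (continuous_inv_sqrt_radicand _ _ _ _ cx cs ct Hx') as cr; cbv beta in cr.
  assert (continuous (fun p : R * R => / (2 * radicand x (fst p) (snd p))) (s, t)).
  { refine (continuous_comp _ Rinv _ _ (continuous_Rinv _ _)).
    - pose proof (continuous_radicand _ _ _ _ cx cs ct); continuity.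
    - simpl; lra. }
  unfold dflux, flux; continuity.
Qed.

(** The inner integral is a difference of boundary values of [flux], whose terms all carry sin (a s)
    or sin ((a + 1) s). *)
Lemma RInt2_dflux (a : nat) (x : R) : 0 < x < 1 -> RInt2 (dflux (INR a) x) 0 PI 0 PI = 0.
Proof.
  intros Hx; unfold RInt2.
  rewrite (RInt_ext _ (fun _ => 0)), RInt_const.
  { unfold scal; simpl; unfold mult; simpl; ring. }
  intros t _; apply is_RInt_unique.
  replace 0 with (minus (flux (INR a) x PI t) (flux (INR a) x 0 t)) at 2.
  - apply (is_RInt_derive (V := R_CompleteNormedModule) (fun s => flux (INR a) x s t)).
    + intros s _; now apply is_derive_flux.
    + intros s _; now apply (continuous_slice_l (dflux (INR a) x)), continuous2_dflux.
  - unfold flux, minus, plus, opp; simpl.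
    rewrite <- S_INR, !sin_INR_PI, !Rmult_0_r, !sin_0; unfold Rdiv; ring.
Qed.

(* The factors 1 give it the shape of [RInt2_lin]. *)
Definition defect (a x s t : R) : R :=
  1 * (1 / (2 * x) * kernel a (a + 1) x s t + (1 - x ^ 2) / 2 * dkernel a (a + 1) x s t)
  + 1 * (- (a + 1 / 4) * kernel a a x s t + (a + 3 / 4) * kernel (a + 1) (a + 1) x s t).

(** The addition formulas split (a + 1) s and (a + 1) t; what remains is algebra modulo sin^2 = 1 -
    cos^2 for s and t and the value of r^2, where r is the root of the radicand. *)
Lemma defect_dflux (a x s t : R) :
  0 < x < 1 ->
  1 * defect a x s t + 1 * defect a x t s = 2 * dflux a x s t + 2 * dflux a x t s.
Proof.
  intros Hx; assert (Hx' : -1 < x < 1) by lra.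
  pose proof (radicand_pos x s t Hx') as Hpos.
  apply sqrt_lt_R0 in Hpos as Hsqrt.
  unfold defect, dflux, flux, dkernel, kernel; rewrite (radicand_swap x t s).
  pose proof (sqrt_sqrt _ (Rlt_le _ _ Hpos)) as HD.
  assert (HD' : radicand x s t = 1 + x ^ 2 - x * (cos s + cos t)) by reflexivity.
  set (D := radicand x s t) in *; set (r := sqrt D) in *; clearbody r D.
  replace ((a + 1) * s) with (a * s + s) by ring.
  replace ((a + 1) * t) with (a * t + t) by ring.
  rewrite !cos_plus, !sin_plus.
  pose proof (sin2_cos2 s) as Hs; pose proof (sin2_cos2 t) as Ht.
  unfold Rsqr in Hs, Ht.
  assert (Hs' : sin s ^ 2 = 1 - cos s ^ 2) by (simpl; lra).
  assert (Hr : r ^ 2 = 1 + x ^ 2 - x * (cos s + cos t)) by (simpl in *; lra).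
  assert (Ht' : sin t ^ 2 = 1 - cos t ^ 2) by (simpl; lra).
  (* D becomes r * r, so the denominators involve only r and x; the expansion of r^2 is kept in [Hr]
     for the final [ring]. *)
  clear HD'; subst D.
  apply Rminus_diag_uniq.
  field_simplify_eq; [| lra].
  ring [Hr Hs' Ht'].
Qed.

(** * Symmetry and the differential-difference relation *)

Lemma Xi2_RInt2 (k l : nat) (x : R) :
  Xi2 k l x = / 4 * RInt2 (kernel (INR k) (INR l) x) 0 PI 0 PI.
Proof. reflexivity. Qed.

Theorem corollary4 (k : nat) :
  (forall x : R, 0 <= x < 1 -> Xi2 k (k + 1) x = Xi2 (k + 1) k x) /\
  (forall x : R, 0 < x < 1 ->
     ex_derive (Xi2 k (k + 1)) x /\
     1 / 2 * (1 / x * Xi2 k (k + 1) x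
              + (1 - x ^ 2) * Derive (Xi2 k (k + 1)) x)
     = (INR k + 1 / 4) * Xi2 k k x
       - (INR k + 3 / 4) * Xi2 (k + 1) (k + 1) x).
Proof.
  pose proof PI_RGT_0 as PIpos.
  split; intros x Hx; assert (Hx' : -1 < x < 1) by lra.
  - rewrite !Xi2_RInt2.
    rewrite RInt2_swap; [| lra | lra | now apply continuous2_kernel].
    f_equal; apply RInt2_ext; intros s t.
    unfold kernel; rewrite radicand_swap; f_equal; apply Rmult_comm.
  - assert (HD : is_derive (Xi2 k (k + 1)) x
              (/ 4 * RInt2 (dkernel (INR k) (INR (k + 1)) x) 0 PI 0 PI)).
    { apply (is_derive_scal (fun y => RInt2 (kernel (INR k) (INR (k + 1)) y) 0 PI 0 PI)).
      now apply is_derive_RInt2_kernel. }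
    split; [eexists; exact HD |].
    rewrite (is_derive_unique _ _ _ HD), !Xi2_RInt2.
    rewrite plus_INR; simpl (INR 1).
    set (a := INR k).
    pose proof (fun b c => continuous2_kernel b c x Hx') as ck.
    pose proof (fun b c => continuous2_dkernel b c x Hx') as cd.
    assert (cdef : continuous2 (defect a x)) by (repeat apply continuous2_lin; auto).
    pose proof (continuous2_dflux a x Hx) as cfl.
    assert (Hdef : RInt2 (defect a x) 0 PI 0 PI = 0).
    { pose proof (RInt2_ext _ _ 0 PI 0 PI (fun s t => defect_dflux a x s t Hx)) as E.
      rewrite (RInt2_lin (defect a x) (fun s t => defect a x t s)),
        (RInt2_lin (dflux a x) (fun s t => dflux a x t s)) in E
        by (lra || assumption || now apply continuous2_swap).
      rewrite <- (RInt2_swap (defect a x)), <- (RInt2_swap (dflux a x)) in E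
        by (lra || assumption).
      unfold a in E at 3 4; rewrite RInt2_dflux in E by exact Hx; lra. }
    unfold defect in Hdef.
    rewrite RInt2_lin, !RInt2_lin in Hdef by (lra || auto using continuous2_lin).
    (* With the factor 1/4 of [Xi2], the expanded integral of [defect] is the left side of the
       relation minus the right side. *)
    apply (f_equal (Rmult (/ 4))) in Hdef; rewrite Rmult_0_r in Hdef.
    apply Rminus_diag_uniq, eq_trans with (2 := Hdef).
    field; lra.
Qed.
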